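(* Let $M$ be a path-circular matroid and let $e\in E(M)$. Then $M\backslash e$ and $M/e$ are both path-circular matroids.
   Context: Let $G$ be a simple graph. A path of $G$ is written as the ordered list of its (distinct) vertices $u_1,\ldots,u_k$, consecutive ones adjacent; paths with zero vertices (''null paths'') and one vertex are allowed. A path-circular collection $\mathcal P$ of $G$ is a collection of (not necessarily distinct) paths of $G$ such that whenever $u_1,\ldots,u_k$ are the vertices in order of a path in $\mathcal P$ and $i\in\{2,\ldots,k-1\}$: (i) $u_i$ has degree $2$ in $G$, and (ii) every path of $\mathcal P$ containing $u_i$ also contains at least one of $u_1,u_k$. If $V(G)=\{v_1,\ldots,v_r\}$, let $N(v_i)=\{p\in\mathcal P: v_i \text{ is a vertex of } p\}$ and let $M(\mathcal P)$ be the transversal matroid on ground set $\mathcal P$ (members of the collection being distinct elements) with presentation $(N(v_1),\ldots,N(v_r))$, i.e. whose independent sets are the sets $\{x_1,\ldots,x_m\}$ of distinct elements for which there are distinct $k_1,\ldots,k_m\in[r]$ with $x_i\in N(v_{k_i})$. A matroid of the form $M(\mathcal P)$ (up to isomorphism) is a path-circular matroid. *)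

(* Defs.v *)
From mathcomp Require Import all_boot.
Set Implicit Arguments. Unset Strict Implicit.
 Unset Printing Implicit Defensive.

Definition simple_graph (V : finType) (adj : rel V) : Prop :=
  symmetric adj /\ irreflexive adj.

Definition deg (V : finType) (adj : rel V) (v : V) : nat := #|[set w | adj v w]|.

Definition gpath (V : finType) (adj : rel V) (p : seq V) : bool :=
  uniq p && (if p is x :: s then path adj x s else true).

(* A path-circular collection, indexed by a finite type I (members of the
   collection are distinct elements even when equal as paths). Internal
   vertices u_i (index 0 < j < k-1, 0-based) have degree 2, and every path of
   the collection containing u_i contains u_1 = head or u_k = last. *)
Definition path_circular (V : finType) (adj : rel V) (I : finType)
    (P : I -> seq V) : Prop :=
  (forall i, gpath adj (P i)) /\
  (forall (i : I) (j : nat) (u : V),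
      0 < j < (size (P i)).-1 -> nth u (P i) j = u ->
      deg adj u = 2 /\
      (forall i' : I, u \in P i' ->
         (head u (P i) \in P i') || (last u (P i) \in P i'))).

(* Independence in the transversal matroid with presentation (N(v))_v,
   N(v) = {p | v in p}: X is independent iff there is an injective
   assignment of vertices to the members of X with x in N(f x). *)
Definition tindep (V : finType) (I : finType) (P : I -> seq V) (X : {set I}) : Prop :=
  exists f : I -> option V,
    (forall x, x \in X -> exists v, f x = Some v /\ v \in P x) /\
    {in X &, injective f}.

Definition path_circular_matroid (E : finType) (indep : {set E} -> Prop) : Prop :=
  exists (V : finType) (adj : rel V) (I : finType) (P : I -> seq V) (phi : E -> I),
    simple_graph adj /\ path_circular adj P /\ bijective phi /\
    (forall X : {set E}, indep X <-> tindep P (phi @: X)).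

Definition del_indep (E : finType) (indep : {set E} -> Prop) (e : E)
    (X : {set {x : E | x != e}}) : Prop :=
  indep [set val x | x in X].

Definition con_indep (E : finType) (indep : {set E} -> Prop) (e : E)
    (X : {set {x : E | x != e}}) : Prop :=
  (indep [set e] -> indep (e |: [set val x | x in X])) /\
  (~ indep [set e] -> indep [set val x | x in X]).
Arguments del_indep {E} indep e X.
Arguments con_indep {E} indep e X.

(* Main.v *)
Require Import Defs.
From mathcomp Require Import all_boot perm zify.

Set Implicit Arguments. Unset Strict Implicit. Unset Printing Implicit Defensive.

(**
Only the edges joining consecutive vertices of paths of the collection matter,
and then path-circularity becomes intrinsic to the paths: the neighbours, in
any path, of an interior vertex of a path [s] are its two neighbours in [s],
and a path containing a vertex of [s] contains everything between that vertex
and one of the two ends of [s].  This is what [thread_family] says.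

Deletion is clear.  The independent sets of the contraction by [e] are the sets
that can be matched with one vertex of [e] left unused.  If [e] is the single
vertex [c], that vertex is removed from all the other paths.  Otherwise write
[e = c, d, ...].  Every other path that contains [d] but not [c] has [d] as
an end; prolong it there by [c], and then remove [c] from [e].  This does not
change the sets that can be matched: if [c] was left unused, the element matched
to [d] moves to [c] and frees [d]; if an element is newly matched to [c], its
path contains all of [d, ...], so it moves to the unused vertex and frees [c].
When [e] has at least three vertices the new collection is again path-circular,
because [d] is interior to [e]; when [e = c, d] it becomes so after the removal
of [d], the two steps together contracting the edge [cd].
*)

Section ConsecutiveVertices.

Variable T : eqType.
Implicit Types (s t : seq T) (a b u v w : T).

Definition consecutive s a b : bool := infix [:: a; b] s || infix [:: b; a] s.

Definition interior s u : bool := 0 < index u s < (size s).-1.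

Lemma consecutiveC s a b : consecutive s a b = consecutive s b a.
Proof. by rewrite /consecutive orbC. Qed.

Lemma consecutive_rev s a b : consecutive (rev s) a b = consecutive s a b.
Proof.
by rewrite /consecutive -(infix_rev [:: a; b]) -(infix_rev [:: b; a]) revK orbC.
Qed.

Lemma consecutive_cons x s a b : consecutive s a b -> consecutive (x :: s) a b.
Proof. by rewrite /consecutive /= => /orP [] ->; rewrite ?orbT. Qed.

Lemma consecutive_cons2 x y s a b :
  consecutive [:: x, y & s] a b =
  consecutive [:: x; y] a b || consecutive (y :: s) a b.
Proof. by rewrite /consecutive /= !prefix0s !andbT !andbF !orbF orbACA. Qed.

Lemma consecutive_seq2 x y a b :
  consecutive [:: x; y] a b = (a == x) && (b == y) || (a == y) && (b == x).
Proof. by rewrite /consecutive /= !andbT !andbF !orbF [(b == x) && _]andbC. Qed.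

Lemma consecutive_meml s a b : consecutive s a b -> a \in s.
Proof. by case/orP => /mem_infix; apply; rewrite !inE eqxx ?orbT. Qed.

Lemma consecutive_memr s a b : consecutive s a b -> b \in s.
Proof. by rewrite consecutiveC => /consecutive_meml. Qed.

Lemma consecutive_nth x0 s i :
  i.+1 < size s -> consecutive s (nth x0 s i) (nth x0 s i.+1).
Proof.
move=> lt_i; apply/orP; left; apply/infixP; exists (take i s), (drop i.+2 s).
by rewrite /= -!drop_nth ?cat_take_drop // ltnW.
Qed.

Lemma index_infix2 s a b :
  uniq s -> infix [:: a; b] s -> index b s = (index a s).+1.
Proof.
move=> Us /infixP [p [q Es]]; move: Us; rewrite Es uniq_catC /= => /and3P [].
rewrite !inE !mem_cat !negb_or => /and3P [ab _ ap] /andP [_ bp] _.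
by rewrite !index_cat (negbTE ap) (negbTE bp) /= !eqxx (negbTE ab) !addnS addn0.
Qed.

Lemma consecutive_index s a b : uniq s -> consecutive s a b ->
  index b s = (index a s).+1 \/ index a s = (index b s).+1.
Proof. by move=> Us /orP [] /(index_infix2 Us); [left | right]. Qed.

Lemma consecutive_neq s a b : uniq s -> consecutive s a b -> a != b.
Proof.
move=> Us /(consecutive_index Us).
by case: eqP => // -> [] /eqP; rewrite ltn_eqF.
Qed.

Lemma consecutive_index_neq s u a b :
  consecutive s u a -> consecutive s u b -> a != b -> index a s != index b s.
Proof.
move=> /consecutive_memr a_s /consecutive_memr b_s; apply: contra => /eqP.
by move/index_inj => ->.
Qed.

Lemma interiorP s u : uniq s ->
  reflect (exists a b, [/\ a != b, consecutive s u a & consecutive s u b])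
          (interior s u).
Proof.
move=> Us; apply: (iffP idP) => [/andP []|[a [b [ab ua ub]]]].
  case Ei: (index u s) => [//|i] _; rewrite ltn_predRL => lt_i.
  have Eu : nth u s i.+1 = u by rewrite -Ei nth_index // -index_mem Ei ltnW.
  exists (nth u s i), (nth u s i.+2); split.
  - by rewrite nth_uniq ?neq_ltn ?leqnSn // ltnW // ltnW.
  - by rewrite consecutiveC -{2}Eu consecutive_nth // ltnW.
  by rewrite -{1}Eu consecutive_nth.
have := consecutive_memr ua; have := consecutive_memr ub; rewrite -!index_mem.
have := consecutive_index_neq ua ub ab; rewrite /interior.
by move: (consecutive_index Us ua) (consecutive_index Us ub); lia.
Qed.

Lemma index_subseq2 s a b : uniq s -> subseq [:: a; b] s ->
  index a s < index b s.
Proof.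
move=> Us ab; have a_s : a \in s by apply: (mem_subseq ab); rewrite mem_head.
case/splitPr: a_s Us ab => p q Us.
rewrite (uniq_subseq_pivot [::] [:: b] Us) sub0seq sub1seq /= => bq.
move: Us; rewrite cat_uniq /= negb_or => /and4P [_ /andP [ap /hasPn qp] aq _].
rewrite index_pivot // index_cat (negbTE (qp b bq)) /=.
by case: eqP => [ab|_]; [rewrite ab bq in aq | rewrite addnS ltnS leq_addr].
Qed.

Lemma index_subseq3 s a u b :
  uniq s -> subseq [:: a; u; b] s -> index a s < index u s < index b s.
Proof.
move=> Us aub; apply/andP; split; apply: index_subseq2 Us (subseq_trans _ aub).
  exact: (prefix_subseq [:: a; u] [:: b]).
exact: subseq_cons.
Qed.

Lemma interior_subseq3 s a u b : uniq s -> subseq [:: a; u; b] s ->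
  interior s u.
Proof.
move=> Us aub; have b_s : b \in s.
  by apply: (mem_subseq aub); rewrite !inE eqxx !orbT.
by move: (index_subseq3 Us aub) b_s; rewrite -index_mem /interior; lia.
Qed.

Lemma subseq_head_last s u :
  uniq s -> interior s u -> subseq [:: head u s; u; last u s] s.
Proof.
rewrite /interior => Us u_int; have us : u \in s by rewrite -index_mem; lia.
case/splitPr: us Us u_int => p q;
  rewrite cat_uniq /= negb_or => /and3P [_ /andP [up _] _].
rewrite index_pivot // size_cat addnS /= last_cat /=.
case: p up => [|x p] //= _; case: q => [|y q] /=; first by rewrite addn0 ltnn.
rewrite eqxx => _; apply: subseq_trans (suffix_subseq p _).
by apply: (cat_subseq (subseq_refl [:: u])); rewrite sub1seq mem_last.
Qed.

Lemma consecutive_closed_subset t (A : pred T) z :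
  (forall a b, consecutive t a b -> A a -> A b) -> z \in t -> A z ->
  {subset t <= A}.
Proof.
move=> closedA zt Az w wt; rewrite unfold_in.
pose eqA := [rel x y | A x == A y].
have trA : transitive eqA by move=> ? ? ? /eqP /= ->.
have sA : sorted eqA t.
  apply/(sortedP z) => i lt_i /=; have := consecutive_nth z lt_i => ci.
  by apply/eqP; apply/idP/idP; apply: closedA; rewrite // consecutiveC.
have eq_le := sorted_leq_index trA (fun=> eqxx _) sA.
have /orP [] := leq_total (index z t) (index w t).
  by move/(eq_le _ _ zt wt)/eqP => <-.
by move/(eq_le _ _ wt zt)/eqP => ->.
Qed.

Lemma infix2_rem v a b s :
  infix [:: a; b] (rem v s) -> infix [:: a; b] s \/ infix [:: a; v; b] s.
Proof.
elim: s => [|x s IH] //=; case: eqP => [->|_] /=.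
  by move=> ab; left; rewrite ab orbT.
case/orP => [|/IH [] ->]; rewrite ?orbT; [|by left|by right].
case/andP => /eqP <-; rewrite eqxx; case: s {IH} => [|y s] //=;
  case: eqP => [->|_] /=.
  by case: s => [|z s] //= /andP [/eqP <- _]; right; rewrite !eqxx prefix0s.
by move=> /andP [/eqP <- _]; left; rewrite eqxx prefix0s.
Qed.

Lemma consecutive_rem v s a b : consecutive (rem v s) a b ->
  consecutive s a b \/ consecutive s v a /\ consecutive s v b.
Proof.
wlog ab : a b / infix [:: a; b] (rem v s) => [ordered|_].
  case/orP => ab; first by apply: (ordered a b ab); rewrite /consecutive ab.
  rewrite consecutiveC and_comm; apply: (ordered b a ab).
  by rewrite /consecutive ab.
have [ab_s|avb_s] := infix2_rem ab; [left|right].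
  by rewrite /consecutive ab_s.
split; apply/orP; [right|left]; apply: infix_trans avb_s.
  exact: (infix_catr _ (infix_refl [:: a; v])).
exact: infix_cons.
Qed.

End ConsecutiveVertices.

Section Threads.

Variable T : eqType.
Implicit Types (s t : seq T) (a b u v w : T).

Definition degree2_at s t u : Prop :=
  forall a b w, consecutive s u a -> consecutive s u b -> a != b ->
  consecutive t u w -> (w == a) || (w == b).

Definition degree2 s t : Prop := forall u, degree2_at s t u.

(* That is, with [u], [t] contains all of [s] on at least one side of [u]. *)
Definition end_closed s t : Prop :=
  forall a u b, subseq [:: a; u; b] s -> u \in t -> (a \in t) || (b \in t).

Lemma degree2_self s : uniq s -> degree2 s s.
Proof.
move=> Us u a b w ua ub ab uw.
apply/negPn/negP; rewrite negb_or => /andP [wa wb].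
have := consecutive_index_neq ua ub ab; have := consecutive_index_neq uw ua wa.
have := consecutive_index_neq uw ub wb; move: (consecutive_index Us uw).
by move: (consecutive_index Us ua) (consecutive_index Us ub); lia.
Qed.

Lemma degree2_at_sub s s' t t' u :
  (forall w, consecutive s' u w -> consecutive s u w) ->
  (forall w, consecutive t' u w -> consecutive t u w) ->
  degree2_at s t u -> degree2_at s' t' u.
Proof. by move=> ss tt D a b w /ss ua /ss ub ab /tt; apply: D. Qed.

Lemma degree2_at_pair s t u x y :
  (forall w, consecutive s u w -> (w == x) || (w == y)) ->
  (forall w, consecutive t u w -> (w == x) || (w == y)) -> degree2_at s t u.
Proof.
move=> sxy txy a b w /sxy ua /sxy ub ab /txy uw.
by case/orP: ua ub uw ab => /eqP -> /orP [] /eqP -> //; rewrite ?eqxx // orbC.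
Qed.

(* A stretch of [s] strictly between two vertices outside [t] is closed under
   taking neighbours in [t]: if it met [t] it would contain all of [t]. *)
Lemma end_closed_of_interior s t : uniq s -> degree2 s t ->
  (forall u, u \in t -> interior s u -> (head u s \in t) || (last u s \in t)) ->
  end_closed s t.
Proof.
move=> Us D ends a u b aub ut; apply/norP => -[a_out b_out].
have [a_s b_s] : a \in s /\ b \in s.
  by split; apply: (mem_subseq aub); rewrite !inE eqxx ?orbT.
pose between z := index a s < index z s < index b s.
have inner z : between z -> interior s z.
  by move: b_s; rewrite -index_mem /between /interior; lia.
have between_t : {subset t <= between}.
  apply: (@consecutive_closed_subset _ _ _ u) => // [z w tzw bz|];
    last exact: index_subseq3.
  have [x [y [xy zx zy]]] := interiorP z Us (inner z bz).
  have szw : consecutive s z w by case/orP: (D z x y w zx zy xy tzw) => /eqP ->.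
  have neq v : v \in s -> v \notin t -> index w s != index v s.
    move=> v_s; apply: contra => /eqP.
    move/(index_inj w (consecutive_memr szw) v_s) <-.
    exact: consecutive_memr tzw.
  move: (neq a a_s a_out) (neq b b_s b_out) (consecutive_index Us szw) bz.
  by rewrite /between; clear; lia.
have u_int := inner u (between_t u ut).
have [/between_t/inner|/between_t/inner] := orP (ends u ut u_int).
  by rewrite /interior; case: (s) => [|x r]; rewrite //= eqxx.
rewrite /interior; case: (s) Us => [|x r] // Us.
by rewrite [last u _]/= index_last // ltnn andbF.
Qed.

Lemma end_closed_rev s t : end_closed s t -> end_closed (rev s) t.
Proof.
by move=> Est a u b; rewrite -subseq_rev revK orbC => bua; apply: Est bua.
Qed.

Lemma end_closed_neighbor s t a u b d :
  uniq s -> end_closed s t -> subseq [:: a; u; b] s -> consecutive s u d ->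
  d \in t -> u \notin t -> (a \in t) || (b \in t).
Proof.
move=> Us Est aub sud dt ut.
wlog /infixP [p [q Es]] : s a b Us Est aub sud / infix [:: u; d] s => [after|].
  case/orP: (sud) => [|du]; first exact: after aub sud.
  rewrite orbC; apply: (after (rev s)); rewrite ?rev_uniq ?consecutive_rev //.
  - exact: end_closed_rev.
  - by rewrite -subseq_rev revK.
  by rewrite -infix_rev revK.
rewrite {}Es /= in Us aub Est; move: (aub).
rewrite (uniq_subseq_pivot [:: a] [:: b] Us) sub1seq sub1seq inE => /andP [_].
case/predU1P => [->|bq]; first by rewrite dt orbT.
have udb : subseq [:: u; d; b] (p ++ [:: u, d & q]).
  by rewrite (uniq_subseq_pivot [::] _ Us) sub0seq /= eqxx sub1seq.
by have := Est u d b udb dt; rewrite (negbTE ut) => /= ->; rewrite orbT.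
Qed.

Lemma end_closed_rem v s t :
  uniq s -> uniq t -> end_closed s t -> end_closed (rem v s) (rem v t).
Proof.
move=> Us Ut Est a u b aub; have sub := mem_subseq aub.
have neq_v x : x \in [:: a; u; b] -> x != v.
  by move=> /sub; rewrite mem_rem_uniq // => /andP [].
rewrite !mem_rem_uniq // !inE !neq_v ?inE ?eqxx ?orbT //=.
exact: Est (subseq_trans aub (rem_subseq v s)).
Qed.

(* The last hypothesis concerns the vertices [u] that stay interior when the
   removal of [v] makes [a] their neighbour instead of [v]. *)
Lemma degree2_at_rem v s t u : uniq s -> uniq t ->
  (u != v -> degree2_at s t u) ->
  (forall a b w, consecutive s u b -> b != v ->
     consecutive s v u -> consecutive s v a -> u != a ->
     consecutive t v u -> consecutive t v w -> u != w -> w = a) ->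
  degree2_at (rem v s) (rem v t) u.
Proof.
move=> Us Ut off_v skip a b w ua ub ab uw.
have neq r y :
    uniq r -> consecutive (rem v r) u y -> [/\ u != v, y != v & u != y].
  move=> Ur uy; rewrite (consecutive_neq (rem_uniq v Ur) uy).
  have := (consecutive_meml uy, consecutive_memr uy).
  by rewrite !mem_rem_uniq // => -[] /andP [-> _] /andP [-> _].
have [/off_v {}off_v av u_a] := neq s a Us ua; have [_ bv u_b] := neq s b Us ub.
have [_ wv u_w] := neq t w Ut uw.
have mixed x y : x != v -> u != y -> consecutive s u x ->
    consecutive s v u -> consecutive s v y -> (w == x) || (w == y).
  move=> xv u_y ux vu vy; have uv : consecutive s u v by rewrite consecutiveC.
  have [tuw|[tvu tvw]] := consecutive_rem uw.
    by have := off_v x v w ux uv xv tuw; rewrite (negbTE wv) orbF => ->.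
  by rewrite (skip y x w) // eqxx orbT.
have [sua|[vu va]] := consecutive_rem ua;
  have [sub|[vu' vb]] := consecutive_rem ub.
- have [tuw|[tvu _]] := consecutive_rem uw; first exact: off_v sua sub ab tuw.
  rewrite consecutiveC in tvu; have := off_v a b v sua sub ab tvu.
  by rewrite eq_sym (negbTE av) eq_sym (negbTE bv).
- exact: mixed.
- by rewrite orbC; apply: mixed.
have := degree2_self Us vu va u_a vb.
by rewrite eq_sym (negbTE u_b) eq_sym (negbTE ab).
Qed.

End Threads.

Section Prolongation.

Variables (T : eqType) (c d : T).
Implicit Types (s t : seq T) (a b u w : T).

(* Meant for an edge [cd] of the contracted path: if [s] contains [d] but not
   [c], then [d] is an end of [s]. *)
Definition prolong s : seq T :=
  if (d \in s) && (c \notin s) then c :: (if head d s == d then s else rev s)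
  else s.

Lemma mem_prolong s z : (z \in prolong s) = (z \in s) || (z == c) && (d \in s).
Proof.
rewrite /prolong; case: (d \in s); last by rewrite andbF orbF.
case: (boolP (c \in s)) => cs /=.
  by case: eqP => [->|]; rewrite ?cs ?orbF.
by rewrite inE andbT orbC; case: eqP => _; rewrite ?mem_rev.
Qed.

Lemma prolong_uniq s : uniq s -> uniq (prolong s).
Proof.
by rewrite /prolong; do 2?case: ifP;
  rewrite //= ?mem_rev ?rev_uniq => _ /andP [_ ->].
Qed.

Lemma prolong_cons2 s : uniq s -> degree2 s [:: c; d] -> d \in s -> c \notin s ->
  exists2 r, prolong s = [:: c, d & r] & d :: r = s \/ d :: r = rev s.
Proof.
move=> Us Ds ds cs; have d_end : ~~ interior s d.
  apply: contra cs => /(interiorP _ Us) [a [b [ab da db]]].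
  have dc : consecutive [:: c; d] d c by rewrite consecutive_seq2 !eqxx orbT.
  case/orP: (Ds d a b c da db ab dc) => /eqP ->;
    first exact: consecutive_memr da.
  exact: consecutive_memr db.
rewrite /prolong ds cs; move: d_end; rewrite /interior.
case/splitPr: ds Us {Ds cs} => p q Us.
have dp : d \notin p.
  by move: Us; rewrite cat_uniq /= negb_or => /and3P [_ /andP []].
rewrite index_pivot //; case: p dp {Us} => [|y p] /= dp.
  by rewrite eqxx => _; exists q; [|left].
have /negbTE -> : y != d by apply: contraNneq dp => ->; rewrite mem_head.
case: q => [|z q]; last by rewrite size_cat /= !addnS !ltnS leq_addr.
by exists (rev (y :: p)); rewrite -cat_cons cats1 rev_rcons; [|right].
Qed.

Lemma consecutive_prolong s u a : uniq s -> degree2 s [:: c; d] ->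
  consecutive (prolong s) u a ->
  consecutive s u a \/ c \notin s /\ consecutive [:: c; d] u a.
Proof.
move=> Us Ds.
have [/andP [ds cs]|/negbTE cds] := boolP ((d \in s) && (c \notin s)).
  have [r -> rs] := prolong_cons2 Us Ds ds cs; rewrite consecutive_cons2.
  by case/orP => ua; [right|left; case: rs ua => ->; rewrite ?consecutive_rev].
by rewrite /prolong cds; left.
Qed.

Lemma degree2_at_prolongl s t u : uniq s -> degree2 s [:: c; d] ->
  u != d -> degree2_at s t u -> degree2_at (prolong s) t u.
Proof.
move=> Us Ds ud D a b w ua ub ab.
have new x : consecutive [:: c; d] u x -> u = c /\ x = d.
  by rewrite consecutive_seq2 (negbTE ud) orbF => /andP [/eqP -> /eqP ->].
have [sua|[cs /new [uc ad]]] := consecutive_prolong Us Ds ua;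
  have [sub|[cs' /new [uc' bd]]] := consecutive_prolong Us Ds ub.
- exact: D sua sub ab.
- by rewrite -uc' (consecutive_meml sua) in cs'.
- by rewrite -uc (consecutive_meml sub) in cs.
by rewrite ad bd eqxx in ab.
Qed.

Lemma degree2_at_prolongr s t u : uniq t -> degree2 t [:: c; d] ->
  degree2_at s [:: c; d] u -> degree2_at s t u -> degree2_at s (prolong t) u.
Proof.
move=> Ut Dt Dcd D a b w ua ub ab /(consecutive_prolong Ut Dt) [|[_]].
  exact: D ua ub ab.
exact: Dcd ua ub ab.
Qed.

Lemma degree2_at_prolong s t u : uniq s -> degree2 s [:: c; d] ->
  uniq t -> degree2 t [:: c; d] -> u != d -> degree2 s t ->
  degree2_at (prolong s) (prolong t) u.
Proof.
move=> Us Ds Ut Dt ud D; apply: degree2_at_prolongr => //.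
  exact: degree2_at_prolongl (Ds u).
exact: degree2_at_prolongl (D u).
Qed.

Lemma consecutive_prolong_interior s a b : uniq s -> degree2 s [:: c; d] ->
  a != b -> consecutive (prolong s) d a -> consecutive (prolong s) d b ->
  (c == a) || (c == b).
Proof.
move=> Us Ds ab da db.
have newE x : consecutive [:: c; d] d x -> c == x.
  by rewrite consecutive_seq2 => /orP [] /andP [/eqP dE /eqP ->]; rewrite ?dE.
have [sda|[_ /newE ->//]] := consecutive_prolong Us Ds da.
have [sdb|[_ /newE ->]] := consecutive_prolong Us Ds db; last by rewrite orbT.
by apply: Ds sda sdb ab _; rewrite consecutive_seq2 !eqxx orbT.
Qed.

Lemma degree2_rem_prolong s t : c != d ->
  uniq s -> degree2 s [:: c; d] -> uniq t -> degree2 t [:: c; d] ->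
  degree2 s t -> degree2 (rem d (prolong s)) (rem d (prolong t)).
Proof.
move=> cd Us Ds Ut Dt D u; have [Ups Upt] := (prolong_uniq Us, prolong_uniq Ut).
apply: degree2_at_rem => // [ud|a b w ub bd du da u_a tdu dw u_w].
  exact: degree2_at_prolong.
have [uc|cu] := eqVneq c u; last first.
  have := consecutive_prolong_interior Us Ds u_a du da.
  have := consecutive_prolong_interior Ut Dt u_w tdu dw.
  by rewrite (negbTE cu) => /eqP <- /eqP <-.
rewrite -{u}uc in du u_a ub u_w {tdu}.
have cs : c \in s.
  have [/consecutive_meml //|[_]] := consecutive_prolong Us Ds ub.
  by rewrite consecutive_seq2 (negbTE cd) (negbTE bd) andbF.
have in_s x : consecutive (prolong s) d x -> consecutive s d x.
  by case/(consecutive_prolong Us Ds) => // -[]; rewrite cs.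
have [tdw|[_]] := consecutive_prolong Ut Dt dw.
  have := D d c a w (in_s c du) (in_s a da) u_a tdw.
  by rewrite eq_sym (negbTE u_w) => /eqP.
rewrite consecutive_seq2 eqxx [d == c]eq_sym (negbTE cd).
by rewrite [w == c]eq_sym (negbTE u_w).
Qed.

Lemma end_closed_prolongl s t : uniq s -> degree2 s [:: c; d] ->
  (d \in t -> c \in t) -> end_closed s t -> end_closed (prolong s) t.
Proof.
move=> Us Ds ct Est; case: (boolP ((d \in s) && (c \notin s))); last first.
  by move=> /negbTE cds; rewrite /prolong cds.
case/andP => ds cs; have [r -> rs] := prolong_cons2 Us Ds ds cs.
have {}Est : end_closed (d :: r) t.
  by case: rs => ->; last apply: end_closed_rev.
have subseq_consE x y p q :
    subseq (x :: p) (y :: q) = subseq (if x == y then p else x :: p) q by [].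
move=> a u b; rewrite subseq_consE; have [->|_] := eqVneq a c; last exact: Est.
rewrite subseq_consE; have [-> _ /ct -> //|_] := eqVneq u d.
move=> ub /(Est d u b); rewrite subseq_consE eqxx => /(_ ub).
by case/orP => [/ct ->|->]; rewrite ?orbT.
Qed.

Lemma end_closed_prolongr s t : uniq s -> degree2 s [:: c; d] ->
  end_closed s t -> end_closed s (prolong t).
Proof.
move=> Us Ds Est a u b aub; rewrite !mem_prolong.
suff ab : (u \in t) || (u == c) && (d \in t) -> (a \in t) || (b \in t).
  by case/ab/orP => ->; rewrite ?orbT.
case: (boolP (u \in t)) => [ut _|ut /= /andP [/eqP uc dt]]; first exact: Est aub ut.
have [x [y [xy ux uy]]] := interiorP u Us (interior_subseq3 Us aub).
have ud : consecutive s u d.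
  have cd : consecutive [:: c; d] u d by rewrite consecutive_seq2 uc !eqxx.
  by case/orP: (Ds u x y d ux uy xy cd) => /eqP ->.
exact: end_closed_neighbor aub ud dt ut.
Qed.

Lemma end_closed_prolong s t : uniq s -> degree2 s [:: c; d] ->
  end_closed s t -> end_closed (prolong s) (prolong t).
Proof.
move=> Us Ds Est.
apply: end_closed_prolongl (end_closed_prolongr _ _ Est) => //.
by rewrite !mem_prolong eqxx => /orP [|/andP [_]] ->; rewrite orbT.
Qed.

Lemma consecutive_second_vertex f r s w :
  uniq [:: c, d, f & r] -> degree2 [:: c, d, f & r] s ->
  consecutive s d w -> (w == c) || (w == f).
Proof.
move=> Ue; apply; first by rewrite /consecutive /= !eqxx prefix0s orbT.
  by rewrite /consecutive /= !eqxx prefix0s !orbT.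
by move: Ue; rewrite /= !inE !negb_or => /andP [/and3P []].
Qed.

Lemma consecutive_prolong_second_vertex f r s w : uniq s -> degree2 s [:: c; d] ->
  uniq [:: c, d, f & r] -> degree2 [:: c, d, f & r] s ->
  consecutive (prolong s) d w -> (w == c) || (w == f).
Proof.
move=> Us Ds Ue De /(consecutive_prolong Us Ds) [|[_]];
  first exact: consecutive_second_vertex De.
by rewrite consecutive_seq2 => /orP [] /andP [/eqP dE /eqP ->];
  rewrite ?dE eqxx.
Qed.

End Prolongation.

Definition thread_family (V : eqType) (I : Type) (P : I -> seq V) : Prop :=
  [/\ forall i, uniq (P i), forall i j, degree2 (P i) (P j)
    & forall i j, end_closed (P i) (P j)].

(* [end_closed (P i) e] is left out: it may fail once the first vertex of [e] is
   removed. *)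
Definition compatible_path (V : eqType) (I : Type) (P : I -> seq V)
    (e : seq V) : Prop :=
  [/\ uniq e, forall i, degree2 (P i) e, forall i, degree2 e (P i)
    & forall i, end_closed e (P i)].

Section ThreadFamilies.

Variables (V : eqType) (I : Type).
Implicit Types (P : I -> seq V) (c d f v : V) (r : seq V).

Lemma thread_family_comp (J : Type) P (phi : J -> I) :
  thread_family P -> thread_family (P \o phi).
Proof. by move=> [U D S]; split=> *; [apply: U | apply: D | apply: S]. Qed.

Lemma thread_family_rem v P : thread_family P ->
  thread_family (fun i => rem v (P i)).
Proof.
move=> [U D S]; split=> [i|i j u|i j];
  [exact: rem_uniq | | exact: end_closed_rem].
apply: degree2_at_rem => // [_|a b w _ _ vu va u_a _ vw u_w]; first exact: D.
by have := D i j v u a w vu va u_a vw; rewrite eq_sym (negbTE u_w) => /eqP.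
Qed.

Lemma compatible_path_degree2_edge c d r P :
  compatible_path P [:: c, d & r] -> forall i, degree2 (P i) [:: c; d].
Proof.
move=> [_ D _ _] i u; apply: degree2_at_sub (D i u) => // w uw.
by rewrite consecutive_cons2 uw.
Qed.

Lemma thread_family_rem_prolong c d P :
  thread_family P -> compatible_path P [:: c; d] ->
  thread_family (fun i => rem d (prolong c d (P i))).
Proof.
move=> [U D S] [Ue De _ _]; split=> [i|i j|i j].
- exact/rem_uniq/prolong_uniq.
- by apply: degree2_rem_prolong; move: Ue; rewrite //= inE andbT.
by apply: end_closed_rem; rewrite ?prolong_uniq //; apply: end_closed_prolong.
Qed.

Lemma thread_family_prolong c d f r P :
  thread_family P -> compatible_path P [:: c, d, f & r] ->
  thread_family (fun i => prolong c d (P i)).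
Proof.
move=> [U D S] Ce; have Dcd := compatible_path_degree2_edge Ce.
have [Ue _ De _] := Ce.
split=> [i|i j u|i j]; [exact: prolong_uniq | | exact: end_closed_prolong].
have [->|ud] := eqVneq u d; last exact: degree2_at_prolong.
by apply: degree2_at_pair => w; apply: consecutive_prolong_second_vertex Ue (De _).
Qed.

Lemma compatible_path_prolong c d f r P :
  (forall i, uniq (P i)) -> compatible_path P [:: c, d, f & r] ->
  compatible_path (fun i => prolong c d (P i)) [:: d, f & r].
Proof.
move=> U Ce; have Dcd := compatible_path_degree2_edge Ce.
have [Ue DPe DeP Se] := Ce; have Dee := degree2_self Ue.
have sub u w :
    consecutive [:: d, f & r] u w -> consecutive [:: c, d, f & r] u w.
  exact: consecutive_cons.
split=> [|i u|i u|i a u b aub].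
- by case/andP: Ue.
- have [->|ud] := eqVneq u d.
    apply: degree2_at_pair => w;
      first exact: consecutive_prolong_second_vertex Ue (DeP i).
    by move/sub; apply: consecutive_second_vertex Dee.
  by apply/degree2_at_prolongl/(degree2_at_sub _ (sub u) (DPe i u)).
- apply: degree2_at_prolongr => //;
    last exact: degree2_at_sub (sub u) _ (DeP i u).
  by apply: degree2_at_sub (sub u) _ (Dee u) => w uw;
    rewrite consecutive_cons2 uw.
have caub : subseq [:: a; u; b] [:: c, d, f & r].
  exact: subseq_trans aub (subseq_cons _ c).
have uc : u != c.
  case/andP: Ue => ce _; apply: contraNneq ce => <-.
  by apply: (mem_subseq aub); rewrite !inE eqxx orbT.
by rewrite !mem_prolong (negbTE uc) orbF => /(Se i a u b caub) /orP [] ->;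
  rewrite ?orbT.
Qed.

End ThreadFamilies.

Section PathCircularCollections.

Variables (V I : finType).
Implicit Types (adj : rel V) (P : I -> seq V).

Lemma gpath_consecutive adj s a b :
  symmetric adj -> gpath adj s -> consecutive s a b -> adj a b.
Proof.
move=> sadj /andP [_ Ps]; have infix_adj x y : infix [:: x; y] s -> adj x y.
  case/infixP => p [q Es]; move: Ps; rewrite {}Es.
  by case: p => [|z p] /=; rewrite ?cat_path /=; [case/andP | case/and4P].
by case/orP => /infix_adj //; rewrite sadj.
Qed.

Lemma path_circular_interior adj P i u :
  path_circular adj P -> interior (P i) u ->
  deg adj u = 2 /\
  forall j, u \in P j -> (head u (P i) \in P j) || (last u (P i) \in P j).
Proof.
move=> [_ Pint] u_int; apply: (Pint i (index u (P i))) => //.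
by apply: nth_index; move: u_int; rewrite -index_mem /interior; lia.
Qed.

Lemma path_circular_thread_family adj P :
  simple_graph adj -> path_circular adj P -> thread_family P.
Proof.
move=> [sadj _] PC; have [gP _] := PC.
have U i : uniq (P i) by case/andP: (gP i).
have edge i u a : consecutive (P i) u a -> a \in [set w | adj u w].
  by rewrite inE; apply: gpath_consecutive.
have D i j : degree2 (P i) (P j).
  move=> u a b w ua ub ab /edge.
  have u_int : interior (P i) u by apply/interiorP; last exists a, b.
  have [degu _] := path_circular_interior PC u_int.
  suff <- : [set a; b] = [set w | adj u w] by rewrite !inE.
  apply/eqP; rewrite eqEcard cards2 ab -/(deg adj u) degu leqnn andbT.
  by rewrite subUset !sub1set (edge i u a) ?(edge i u b).
split=> // i j; apply: end_closed_of_interior => // u uj u_int.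
by have [_] := path_circular_interior PC u_int; apply.
Qed.

Lemma thread_family_path_circular P :
  thread_family P ->
  exists2 adj : rel V, simple_graph adj & path_circular adj P.
Proof.
move=> [U D S]; pose adj u w := [exists i, consecutive (P i) u w].
exists adj.
  split=> [u w|u]; first by apply: eq_existsb => i; rewrite consecutiveC.
  by apply/existsP => [[i /(consecutive_neq (U i))]]; rewrite eqxx.
split=> [i|i k u k_int ku].
  rewrite /gpath U -/(sorted adj (P i)) /=; case Ei: (P i) => [//|x s].
  apply/(sortedP x) => k lt_k; apply/existsP; exists i.
  by rewrite Ei consecutive_nth.
have u_int : interior (P i) u.
  rewrite /interior; suff -> : index u (P i) = k by [].
  rewrite -ku index_uniq //; case/andP: k_int => _ lt_k.
  exact: leq_trans lt_k (leq_pred _).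
have [a [b [ab ua ub]]] := interiorP u (U i) u_int.
split=> [|j uj]; last exact: S (subseq_head_last (U i) u_int) uj.
have -> : deg adj u = #|[set a; b]|; last by rewrite cards2 ab.
congr #|pred_of_set _|; apply/setP => w; rewrite !inE.
apply/existsP/idP => [[j /(D i j u a b w ua ub ab) //]|].
by case/orP => /eqP ->; exists i.
Qed.

End PathCircularCollections.

Lemma tindep_imset (V I J : finType) (P : I -> seq V) (phi : J -> I)
    (X : {set J}) :
  injective phi -> tindep P (phi @: X) <-> tindep (P \o phi) X.
Proof.
move=> phi_inj; split=> [[f [fP f_inj]]|[f [fP f_inj]]].
  exists (f \o phi); split=> [x xX|x y xX yX /= fxy]; first by apply/fP/imset_f.
  by apply/phi_inj/f_inj; rewrite ?imset_f.
pose g i := if [pick x in X | phi x == i] is Some x then f x else None.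
have gE x : x \in X -> g (phi x) = f x.
  move=> xX; rewrite /g.
  case: pickP => [y /andP [_ /eqP /phi_inj -> //]|/(_ x)].
  by rewrite xX eqxx.
exists g; split=> [_ /imsetP [x xX ->]|_ _ /imsetP [x xX ->] /imsetP [y yX ->]].
  by rewrite gE //; apply: fP.
by rewrite !gE // => /f_inj ->.
Qed.

Section Matchings.

Variables (V I : finType).
Implicit Types (P Q : I -> seq V) (X : {set I}) (c d m : V) (r e : seq V).

Definition matching P X (f : I -> option V) : Prop :=
  (forall x, x \in X -> exists v, f x = Some v /\ v \in P x) /\
  {in X &, injective f}.

Definition tindep_sparing P e X : Prop :=
  exists2 m, m \in e & tindep (fun x => rem m (P x)) X.

Lemma matching_omap P Q X f (g : V -> V) : injective g -> matching P X f ->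
  (forall x v, x \in X -> f x = Some v -> v \in P x -> g v \in Q x) ->
  tindep Q X.
Proof.
move=> g_inj [fP f_inj] gPQ; exists (omap g \o f); split=> [x xX|x y xX yX].
  by have [v [fx vx]] := fP x xX; exists (g v); rewrite /= fx; split=> //;
    apply: gPQ fx vx.
by move/(inj_omap g_inj); apply: f_inj.
Qed.

Lemma tindep_set1 P i : tindep P [set i] <-> P i != [::].
Proof.
split=> [[f [fP _]]|].
  by have [v [_]] := fP i (set11 i); case: (P i).
case Ei: (P i) => [|v s] // _; exists (fun=> Some v); split=> [x /set1P ->|x y].
  by exists v; rewrite Ei mem_head.
by move=> /set1P -> /set1P ->.
Qed.

Lemma tindep_setU1 P i X : (forall x, uniq (P x)) -> i \notin X ->
  tindep P (i |: X) <-> tindep_sparing P (P i) X.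
Proof.
move=> U iX; split=> [[f [fP f_inj]]|[m mi [f [fP f_inj]]]].
  have [m [fi mi]] := fP i (setU11 i X); exists m => //; exists f.
  split=> [x xX|x y xX yX]; last by apply: f_inj; rewrite setU1r.
  have [v [fx vx]] := fP x (setU1r i xX); exists v; split=> //.
  rewrite mem_rem_uniq // inE vx andbT; apply: contraNneq iX => vm.
  by rewrite (f_inj i x (setU11 i X) (setU1r i xX)) // fi fx vm.
have fm x : x \in X -> f x != Some m.
  move=> /fP [v [-> ]]; rewrite mem_rem_uniq // => /andP [/= vm _].
  by apply: contra vm => /eqP [->].
exists (fun x => if x == i then Some m else f x); split=> [x|x y].
  rewrite !inE; case: eqP => [->|_] /= xX; first by exists m.
  by have [v [-> /mem_rem vx]] := fP x xX; exists v.
rewrite !inE; case: eqP => [->|_] /= xX; case: eqP => [->|_] /= yX // fxy.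
- by have := fm y yX; rewrite -fxy eqxx.
- by have := fm x xX; rewrite fxy eqxx.
exact: f_inj.
Qed.

Lemma tindep_sparing_prolong c d r P X : c != d -> (forall x, uniq (P x)) ->
  tindep_sparing P [:: c, d & r] X ->
  tindep_sparing (fun x => prolong c d (P x)) (d :: r) X.
Proof.
move=> cd U [m + [f mf]].
have Up x : uniq (prolong c d (P x)) by apply: prolong_uniq.
rewrite inE => /predU1P [mc|me]; last first.
  exists m => //; apply: (matching_omap (g := id) (@inj_id _) mf) => x v _ _.
  by rewrite !mem_rem_uniq // !inE mem_prolong => /andP [-> ->].
exists d; first exact: mem_head.
apply: (matching_omap (g := tperm c d) perm_inj mf) => x v _ _.
rewrite mc !mem_rem_uniq // !inE mem_prolong => /andP [vc vx].
case: tpermP vc vx => [->|-> _ dx|_ /eqP/negbTE -> _ -> //];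
  first by rewrite eqxx.
by rewrite cd eqxx dx orbT.
Qed.

Lemma tindep_sparing_of_prolong c d r P X :
  uniq [:: c, d & r] -> (forall x, uniq (P x)) ->
  (forall x, end_closed [:: c, d & r] (P x)) ->
  tindep_sparing (fun x => prolong c d (P x)) (d :: r) X ->
  tindep_sparing P [:: c, d & r] X.
Proof.
move=> Ue U S [m me [f mf]].
have Up x : uniq (prolong c d (P x)) by apply: prolong_uniq.
have cm : c != m by case/andP: Ue => ce _; apply: contraNneq ce => ->.
have mP x : c \notin P x -> d \in P x -> m \in P x.
  move=> cx dx; move: me; rewrite inE => /predU1P [-> //|mr].
  have cdm : subseq [:: c; d; m] [:: c, d & r] by rewrite /= !eqxx sub1seq.
  by have := S x c d m cdm dx; rewrite (negbTE cx).
case: (boolP [exists y in X, (f y == Some c) && (c \notin P y)]); last first.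
  move=> old; exists m; first by rewrite inE me orbT.
  apply: (matching_omap (g := id) (@inj_id _) mf) => x v xX fx.
  rewrite !mem_rem_uniq // !inE mem_prolong => /andP [-> /orP [//|]].
  case/andP => /eqP vc _.
  apply: contraR old => cx; apply/exists_inP; exists x => //.
  by rewrite fx vc eqxx -vc.
case/exists_inP => y yX /andP [/eqP fy cy]; exists c; first exact: mem_head.
apply: (matching_omap (g := tperm c m) perm_inj mf) => x v xX fx.
case: tpermP => [vc|->|/eqP vc _];
  rewrite !mem_rem_uniq // !inE ?eqxx ?mem_prolong //.
  have -> : x = y by case: mf => _; apply; rewrite // fx fy vc.
  by rewrite [m == c]eq_sym cm vc (negbTE cy) eqxx => /andP [_ /(mP y cy)].
by rewrite vc (negbTE vc) orbF => /andP [].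
Qed.

Lemma tindep_sparing_prolongE c d r P X : uniq [:: c, d & r] ->
  (forall x, uniq (P x)) -> (forall x, end_closed [:: c, d & r] (P x)) ->
  tindep_sparing (fun x => prolong c d (P x)) (d :: r) X <->
  tindep_sparing P [:: c, d & r] X.
Proof.
move=> Ue U S; split; first exact: tindep_sparing_of_prolong.
apply: tindep_sparing_prolong => //.
by move: Ue; rewrite /= inE negb_or => /andP [/andP []].
Qed.

Lemma tindep_sparing_seq1 P v X :
  tindep_sparing P [:: v] X <-> tindep (fun x => rem v (P x)) X.
Proof.
by split=> [[m]|]; [rewrite mem_seq1 => /eqP -> | exists v; rewrite ?mem_head].
Qed.

Lemma thread_family_contract P e :
  thread_family P -> compatible_path P e -> e != [::] ->
  exists2 Q : I -> seq V,
    thread_family Q & forall X, tindep Q X <-> tindep_sparing P e X.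
Proof.
elim: e P => [|c [|d [|f r]] IH] P tP Ce // _.
all: have [[U _ _] [Ue _ _ S]] := (tP, Ce).
- exists (fun i => rem c (P i)); first exact: thread_family_rem.
  by move=> X; rewrite tindep_sparing_seq1.
- exists (fun i => rem d (prolong c d (P i)));
    first exact: thread_family_rem_prolong.
  by move=> X; rewrite -tindep_sparing_prolongE // tindep_sparing_seq1.
have [//|Q tQ indepQ] :=
  IH _ (thread_family_prolong tP Ce) (compatible_path_prolong U Ce).
by exists Q => // X; rewrite indepQ tindep_sparing_prolongE.
Qed.

End Matchings.

Lemma tindep_sparing_imset (V I J : finType) (P : I -> seq V) (phi : J -> I)
    (e : seq V) (X : {set J}) : injective phi ->
  tindep_sparing P e (phi @: X) <-> tindep_sparing (P \o phi) e X.
Proof.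
move=> phi_inj; split=> -[m me indepX]; exists m => //.
  exact: (tindep_imset (fun x => rem m (P x)) X phi_inj).1.
exact: (tindep_imset (fun x => rem m (P x)) X phi_inj).2.
Qed.

Lemma path_circular_matroidP (E : finType) (indep : {set E} -> Prop) :
  path_circular_matroid indep <->
  exists (V : finType) (P : E -> seq V),
    thread_family P /\ forall X, indep X <-> tindep P X.
Proof.
split=> [[V [adj [I [P [phi [sg [pc [bij_phi indepE]]]]]]]]|[V [P [tP indepE]]]].
  exists V, (P \o phi); split.
    exact/thread_family_comp/(path_circular_thread_family sg pc).
  by move=> X; rewrite indepE tindep_imset //; apply: bij_inj.
have [adj sg pc] := thread_family_path_circular tP.
exists V, adj, E, P, id; split=> //; split=> //; split; first by exists id.
by move=> X; rewrite imset_id.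
Qed.

Lemma path_circular_matroid_del (E : finType) (indep : {set E} -> Prop) (e : E) :
  path_circular_matroid indep -> path_circular_matroid (del_indep indep e).
Proof.
move=> /path_circular_matroidP [V [P [tP indepE]]];
  apply/path_circular_matroidP.
exists V, (P \o val); split; first exact: thread_family_comp.
by move=> X; rewrite /del_indep indepE tindep_imset //; apply: val_inj.
Qed.

Lemma con_indep_loop (E : finType) (indep : {set E} -> Prop) (e : E) X :
  ~ indep [set e] -> con_indep indep e X <-> del_indep indep e X.
Proof. by rewrite /con_indep => loop_e; split=> [[_ /(_ loop_e)]|]. Qed.

Lemma con_indep_nonloop (E : finType) (indep : {set E} -> Prop) (e : E) X :
  indep [set e] -> con_indep indep e X <-> indep (e |: [set val x | x in X]).
Proof. by rewrite /con_indep => indep_e; split=> [[/(_ indep_e)]|]. Qed.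

Lemma path_circular_matroid_con (E : finType) (indep : {set E} -> Prop) (e : E) :
  path_circular_matroid indep -> path_circular_matroid (con_indep indep e).
Proof.
move=> pcM; have /path_circular_matroidP [V [P [tP indepE]]] := pcM.
apply/path_circular_matroidP; have [Pe|Pe] := altP (P e =P [::]).
  have loop_e : ~ indep [set e] by rewrite indepE tindep_set1 Pe.
  have /path_circular_matroidP [W [Q [tQ delE]]] := path_circular_matroid_del e pcM.
  by exists W, Q; split=> // X; rewrite con_indep_loop.
have [U D S] := tP; pose P' := P \o (val : {x | x != e} -> E).
have Ce : compatible_path P' (P e).
  by split=> [|x u|x u|x]; [exact: U | exact: D | exact: D | exact: S].
have [Q tQ indepQ] := thread_family_contract (thread_family_comp _ tP) Ce Pe.
exists V, Q; split=> // X; rewrite con_indep_nonloop;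
  last by rewrite indepE tindep_set1.
have eX : e \notin [set val x | x in X].
  by apply/imsetP => -[x _ xe]; have := valP x; rewrite -xe eqxx.
by rewrite indepE tindep_setU1 // indepQ tindep_sparing_imset //;
  apply: val_inj.
Qed.

Theorem theorem1p3 (E : finType) (indep : {set E} -> Prop) (e : E) :
  path_circular_matroid indep ->
  path_circular_matroid (del_indep indep e) /\
  path_circular_matroid (con_indep indep e).
Proof.
by move=> pcM; split;
  [apply: path_circular_matroid_del | apply: path_circular_matroid_con].
Qed.
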